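(* For every finite standard closure space $(U,\varphi)$ with lattice of closed sets $(\mathcal{C},\subseteq)$, there exists a finite standard closure space $(T,\psi)$ with lattice of closed sets $(\mathcal{F},\subseteq)$ such that $(\mathcal{C},\subseteq)$ is (isomorphic to) a sublattice of $(\mathcal{F},\subseteq)$ and the $E$-base of $(T,\psi)$ is valid.
   Context: A closure space $(U,\varphi)$: finite $U$ with closure operator $\varphi$ on $2^U$; closed sets form a lattice under inclusion (meet $\cap$, join $\varphi(C_1\cup C_2)$). Standard: $\varphi(\{x\})\setminus\{x\}$ closed for all $x\in U$. $\varphi^b(X)=\bigcup_{x\in X}\varphi(\{x\})$. $D$-generator of $x$: $A\subseteq U$ with $x\in\varphi(A)$, $x\notin\varphi^b(A)$, and $x\notin\varphi(B)$ for all $B$ with $\varphi^b(B)\subsetneq\varphi^b(A)$. $E$-generator of $x$: $D$-generator $A$ of $x$ with $\varphi(A)$ inclusion-minimal among closures of $D$-generators of $x$. $E$-base: $\Sigma_E=\{a\to x: x\neq a,x\in\varphi(\{a\})\}\cup\{A\to x: A \text{ an } E\text{-generator of } x\}$. A set $\Sigma$ of implications $A\to X$ induces the closure operator whose closed sets $C$ satisfy $A\subseteq C\Rightarrow X\subseteq C$ for all $A\to X\in\Sigma$; the $E$-base is valid if this operator equals the space's closure operator. *)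

(* Defs.v *)
From HB Require Import structures.
From mathcomp Require Import all_boot.

Set Implicit Arguments.
Unset Strict Implicit.
Unset Printing Implicit Defensive.

Section ClosureSpaces.

Variable U : finType.
Implicit Types (phi : {set U} -> {set U}) (A B C X Y : {set U}) (x a : U).

Definition closure_operator phi : Prop :=
  [/\ forall X, X \subset phi X,
      forall X Y, X \subset Y -> phi X \subset phi Y
    & forall X, phi (phi X) = phi X].

Definition closed phi C : bool := phi C == C.

Definition closed_sets phi : {set {set U}} := [set C | closed phi C].

(* This forces phi set0 = set0. *)
Definition standard phi : Prop :=
  forall x, closed phi (phi [set x] :\ x).

Definition standard_closure_space phi : Prop :=
  closure_operator phi /\ standard phi.

Definition bin_closure phi X : {set U} := \bigcup_(x in X) phi [set x].

Definition D_generator phi A x : bool :=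
  [&& x \in phi A,
      x \notin bin_closure phi A
    & [forall B : {set U},
        (bin_closure phi B \proper bin_closure phi A) ==> (x \notin phi B)]].

Definition E_generator phi A x : bool :=
  D_generator phi A x &&
  [forall B : {set U}, D_generator phi B x ==> ~~ (phi B \proper phi A)].

(* The implication A -> X is the pair (A, X). *)
Definition E_base phi : {set {set U} * {set U}} :=
  [set ([set a], [set x]) | a in [set: U], x in [set: U]
      & (x != a) && (x \in phi [set a])]
  :|: [set (A, [set x]) | A in [set: {set U}], x in [set: U]
      & E_generator phi A x].

Definition model (Sigma : {set {set U} * {set U}}) C : bool :=
  [forall p in Sigma, (p.1 \subset C) ==> (p.2 \subset C)].

Definition induced_closure (Sigma : {set {set U} * {set U}}) X : {set U} :=
  \bigcap_(C : {set U} | model Sigma C && (X \subset C)) C.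

Definition E_base_valid phi : Prop :=
  forall X, induced_closure (E_base phi) X = phi X.

(* In the lattice of closed sets the meet is :&: and the join of C1 and C2 is
   phi (C1 :|: C2); bounds need not be preserved. *)
Definition sublattice phi (S : {set {set U}}) : Prop :=
  S \subset closed_sets phi /\
  {in S &, forall C1 C2, C1 :&: C2 \in S /\ phi (C1 :|: C2) \in S}.

End ClosureSpaces.

(* Isomorphism of families ordered by inclusion; the order determines the
   lattice operations. *)
Definition inclusion_isomorphic (U T : finType)
    (C : {set {set U}}) (S : {set {set T}}) : Prop :=
  exists2 f : {set U} -> {set T},
    f @: C = S & {in C &, {mono f : X Y / X \subset Y}}.

(* Main.v *)
(** The E-base fails to be valid when a D-generator [A] of [x] does not have
    minimal closure, so that [A -> x] is lost.  For every [x] in [phi A] but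
    not in [bin_closure phi A], add a new point [y] with [A -> y] and
    [y -> x].  A closed set avoiding [y] can only acquire [y] by containing
    [A], hence all generators of [y] have closure above that of [A], and
    some set inside the binary closure of [A] is an E-generator of [y].
    Thus [A -> x] is recovered from the E-base through [y].  Sending a closed
    set [C] to [C] together with the new points whose premise lies in [C]
    preserves meets and joins. *)
From HB Require Import structures.
From mathcomp Require Import all_boot.
Require Import Defs.

Set Implicit Arguments.
Unset Strict Implicit.
Unset Printing Implicit Defensive.

(** * General facts on closure operators, D-generators and models of the E-base *)

Section ClosureFacts.

Variables (U : finType) (phi : {set U} -> {set U}).
Hypothesis cl_phi : closure_operator phi.
Implicit Types (A B C M X Y : {set U}) (x : U).

Lemma sub_closure X : X \subset phi X.
Proof. by case: cl_phi. Qed.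

Lemma closureS X Y : X \subset Y -> phi X \subset phi Y.
Proof. by case: cl_phi => _ + _; apply. Qed.

Lemma closure_idem X : phi (phi X) = phi X.
Proof. by case: cl_phi. Qed.

Lemma closure_min X C : closed phi C -> X \subset C -> phi X \subset C.
Proof. by move=> /eqP {2}<-; apply: closureS. Qed.

Lemma sub_closedP C : reflect (closed phi C) (phi C \subset C).
Proof. by rewrite /closed eqEsubset sub_closure andbT; apply: idP. Qed.

Lemma sub_bin_closure X : X \subset bin_closure phi X.
Proof.
apply/subsetP=> x xX; apply/bigcupP; exists x => //.
exact: (subsetP (sub_closure _)) (set11 x).
Qed.

Lemma bin_closure_sub X : bin_closure phi X \subset phi X.
Proof. by apply/bigcupsP=> x xX; apply: closureS; rewrite sub1set. Qed.

(** Otherwise [X], which misses [x], would lie in the closed set [phi [set x] :\ x], and then so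
    would [phi X]. *)
Lemma standard_unreachable X x : standard phi ->
  x \in phi X -> x \notin bin_closure phi X -> ~~ (X \subset phi [set x]).
Proof.
move=> std xX xNX; apply/negP => sX.
suff /(closure_min (std x))/subsetP/(_ x xX) : X \subset phi [set x] :\ x.
  by rewrite !inE eqxx.
rewrite subsetD1 sX; apply: contra xNX.
exact: (subsetP (sub_bin_closure X)).
Qed.

Lemma D_generator_below X x :
  x \in phi X -> x \notin bin_closure phi X ->
  exists2 A, D_generator phi A x & bin_closure phi A \subset bin_closure phi X.
Proof.
move=> xX xNX.
pose P A := (x \in phi A) && (bin_closure phi A \subset bin_closure phi X).
have PX : P X by rewrite /P xX subxx.
(* Choose [A] with binary closure of least cardinality: a counterexample [B] to D-minimality would
   again satisfy [P], with a strictly smaller binary closure. *)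
case: (arg_minnP (fun A => #|bin_closure phi A|) PX) => A /andP[xA sA] minA.
exists A => //; apply/and3P; split=> //.
  by apply: contra xNX; apply: (subsetP sA).
apply/forallP=> B; apply/implyP=> ltBA; apply/negP=> xB.
have /minA : P B by rewrite /P xB (subset_trans (proper_sub ltBA)).
by rewrite leqNgt proper_card.
Qed.

Lemma E_base_model_closed C : closed phi C -> model (E_base phi) C.
Proof.
move=> clC; apply/forallP=> p; apply/implyP=> /setUP[] /imset2P[a x _] /=.
  rewrite inE => /and3P[_ _ xa] -> /=.
  apply/implyP=> /(closure_min clC) sC; rewrite sub1set.
  exact: (subsetP sC).
rewrite inE => /and3P[_ /and3P[xa _ _] _] -> /=.
apply/implyP=> /(closure_min clC) sC; rewrite sub1set.
exact: (subsetP sC).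
Qed.

(** Closed sets are always models of the E-base, so validity reduces to the converse. *)
Lemma E_base_validP :
  (forall M, model (E_base phi) M -> closed phi M) -> E_base_valid phi.
Proof.
move=> clM X; apply/eqP; rewrite eqEsubset; apply/andP; split.
  apply: bigcap_inf; rewrite sub_closure andbT.
  by apply: E_base_model_closed; rewrite /closed closure_idem.
by apply/bigcapsP=> M /andP[/clM clC sXM]; apply: closure_min.
Qed.

Lemma model_bin_closure M X :
  model (E_base phi) M -> X \subset M -> bin_closure phi X \subset M.
Proof.
move=> /forallP modM sXM; apply/bigcupsP=> a aX; apply/subsetP=> x xa.
have aM := subsetP sXM _ aX.
have [->//|neq] := eqVneq x a.
have /implyP := modM ([set a], [set x]); rewrite /= !sub1set aM; apply.
by apply/setUP; left; apply/imset2P; exists a x; rewrite ?inE ?neq.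
Qed.

Lemma model_E_generator M X x :
  model (E_base phi) M -> E_generator phi X x -> X \subset M -> x \in M.
Proof.
move=> /forallP modM genX sXM.
have /implyP := modM (X, [set x]); rewrite /= sub1set sXM; apply.
by apply/setUP; right; apply/imset2P; exists X x; rewrite ?inE.
Qed.

End ClosureFacts.

(** * The extended space and its closure operator *)

Section Extension.

Variables (U : finType) (phi : {set U} -> {set U}).
Hypotheses (cl_phi : closure_operator phi) (std_phi : standard phi).

Definition nonbinary_pair (p : {set U} * U) : bool :=
  (p.2 \in phi p.1) && (p.2 \notin bin_closure phi p.1).

(* The new point [inr y] stands between premise [(val y).1] and conclusion
   [(val y).2]. *)
Definition extension : finType := (U + {p | nonbinary_pair p})%type.

Implicit Types (Z M : {set extension}) (t : extension) (A C D X : {set U}).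

Definition base_point t : U :=
  match t with inl u => u | inr y => (val y).2 end.

Definition ext_lift C : {set extension} :=
  [set t : extension |
    match t with inl u => u \in C | inr y => (val y).1 \subset C end].

(** [base_point] encodes the implications from new points to their conclusions. [Z] is kept because
    it may hold new points whose premises are not generated; a single lift suffices, as lifting a
    closed set adds no base points. *)
Definition ext_closure Z : {set extension} :=
  Z :|: ext_lift (phi (base_point @: Z)).

Lemma ext_liftS C D : C \subset D -> ext_lift C \subset ext_lift D.
Proof.
move=> sCD; apply/subsetP=> [[u|y]]; rewrite !inE; first exact: (subsetP sCD).
by move=> sC; apply: subset_trans sCD.
Qed.

Lemma base_point_lift C : closed phi C -> base_point @: ext_lift C = C.
Proof.
move=> clC; apply/eqP; rewrite eqEsubset; apply/andP; split; last first.
  by apply/subsetP=> u uC; apply/imsetP; exists (inl u); rewrite ?inE.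
apply/subsetP=> _ /imsetP[[u|y] + ->]; rewrite inE //= => sC.
have /andP[xA _] := valP y.
exact: (subsetP (closure_min cl_phi clC sC)).
Qed.

Lemma closed_phi X : closed phi (phi X).
Proof. by rewrite /closed closure_idem. Qed.

Lemma base_point_closure Z : base_point @: ext_closure Z = phi (base_point @: Z).
Proof.
rewrite imsetU base_point_lift ?closed_phi //.
exact/setUidPr/sub_closure.
Qed.

Lemma ext_closure_operator : closure_operator ext_closure.
Proof.
split=> [Z|Y Z sYZ|Z]; first exact: subsetUl.
  by apply/setUSS/ext_liftS/closureS/imsetS.
rewrite {1}/ext_closure base_point_closure closure_idem //.
by apply/setUidPl/subsetUr.
Qed.

Lemma ext_lift_closed C : closed phi C -> closed ext_closure (ext_lift C).
Proof.
move=> clC; rewrite /closed /ext_closure base_point_lift //.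
by rewrite (eqP clC) setUid.
Qed.

Lemma ext_closure1 t : ext_closure [set t] = t |: ext_lift (phi [set base_point t]).
Proof. by rewrite /ext_closure imset_set1. Qed.

Lemma base_point_inl A : base_point @: (@inl _ _ @: A) = A.
Proof. by rewrite -imset_comp -[RHS]imset_id; apply: eq_imset. Qed.

Lemma base_point_bin t M : t \in M ->
  inl (base_point t) \in bin_closure ext_closure M.
Proof.
move=> tM; apply/bigcupP; exists t => //.
rewrite ext_closure1 !inE; apply/orP; right.
exact: (subsetP (sub_closure cl_phi _)) (set11 _).
Qed.

(** * Standardness of the extension *)

Lemma premise_not_sub (y : {p | nonbinary_pair p}) :
  ~~ ((val y).1 \subset phi [set (val y).2]).
Proof. by have /andP[] := valP y; apply: standard_unreachable. Qed.

Lemma ext_standard : standard ext_closure.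
Proof.
case=> [u|y]; rewrite ext_closure1 setDUl setDv set0U /=.
  set Z := _ :\ _.
  have sZ : base_point @: Z \subset phi [set u].
    by rewrite -(base_point_lift (closed_phi [set u])) imsetS ?subsetDl.
  apply/(sub_closedP ext_closure_operator).
  rewrite subUset subxx /= subsetD1; apply/andP; split.
    exact/ext_liftS/(closure_min cl_phi (closed_phi _)).
  suff sub : phi (base_point @: Z) \subset phi [set u] :\ u.
    by rewrite inE; apply/negP => /(subsetP sub); rewrite !inE eqxx.
  apply: (closure_min cl_phi) => //; rewrite subsetD1 sZ.
  (* No element of [Z] has base point [u]: the old copy was removed, and a new point with conclusion
     [u] would have its premise inside [phi [set u]], against standardness of [phi]. *)
  apply/imsetP=> -[[v|y] + def_u]; rewrite !inE => /andP[].
    by rewrite def_u eqxx.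
  by rewrite def_u /= (negPf (premise_not_sub y)).
(* A new point is outside the lift of its conclusion's closure, so removing it leaves exactly that
   closed lift. *)
have yN : inr y \notin ext_lift (phi [set (val y).2]).
  by rewrite inE premise_not_sub.
rewrite (setDidPl _); first exact/ext_lift_closed/closed_phi.
by rewrite disjoint_sym disjoints1.
Qed.

(** * Validity of the E-base *)

Lemma premise_mem (y : {p | nonbinary_pair p}) Z :
  inr y \in ext_closure Z -> inr y \notin Z ->
  (val y).1 \subset phi (base_point @: Z).
Proof. by rewrite !inE => /orP[-> //|]. Qed.

Lemma ext_closure_inl A : ext_closure (@inl _ _ @: A) = ext_lift (phi A).
Proof.
rewrite /ext_closure base_point_inl; apply/setUidPr/subsetP=> _ /imsetP[u uA ->].
by rewrite inE (subsetP (sub_closure cl_phi A)).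
Qed.

Lemma ext_E_generator (y : {p | nonbinary_pair p}) :
  exists2 B, E_generator ext_closure B (inr y) &
    bin_closure ext_closure B
      \subset bin_closure ext_closure (@inl _ _ @: (val y).1).
Proof.
have cl_ext := ext_closure_operator.
have /andP[xA xNA] := valP y; set A := (val y).1 in xA xNA *.
have yA : inr y \in ext_closure (@inl _ _ @: A).
  by rewrite ext_closure_inl inE sub_closure.
have yNA : inr y \notin bin_closure ext_closure (@inl _ _ @: A).
  (* If one [a] in [A] generated [y], then [A], hence the conclusion, would lie in [phi [set a]],
     making the implication binary. *)
  apply: contra xNA => /bigcupP[_ /imsetP[a aA ->]].
  rewrite ext_closure1 !inE /= => sA; apply/bigcupP; exists a => //.
  exact: (subsetP (closure_min cl_phi (closed_phi _) sA)).
have [B genB sB] := D_generator_below yA yNA.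
exists B => //; rewrite /E_generator genB /=.
apply/forallP=> B'; apply/implyP=> /and3P[yB' yNB' _].
rewrite properE; apply/nandP; right; rewrite negbK.
(* Any D-generator [B'] of [y] avoids [y], so its closure gets [y] only through the premise [A]; it
   therefore contains the lift of [phi A], which contains the closure of [B]. *)
have sAB' : A \subset phi (base_point @: B').
  apply: premise_mem => //; apply: contra yNB'.
  exact: (subsetP (sub_bin_closure cl_ext _)).
have sBA : ext_closure B \subset ext_lift (phi A).
  rewrite -ext_closure_inl; apply: (closure_min cl_ext).
    by rewrite /closed (closure_idem cl_ext).
  apply: subset_trans (sub_bin_closure cl_ext B) _.
  exact: subset_trans sB (bin_closure_sub cl_ext _).
apply: (subset_trans sBA); apply: subset_trans (subsetUr _ _).
exact/ext_liftS/(closure_min cl_phi (closed_phi _)).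
Qed.

Lemma ext_E_base_valid : E_base_valid ext_closure.
Proof.
have cl_ext := ext_closure_operator.
apply: (E_base_validP cl_ext) => M modM.
have binM := model_bin_closure modM (subxx M).
have inlM t : t \in M -> inl (base_point t) \in M.
  by move=> /base_point_bin; apply: (subsetP binM).
have inrM (y : {p | nonbinary_pair p}) :
    (val y).1 \subset base_point @: M -> inr y \in M.
  (* The generator [B] may differ from the copy of the premise, but it lies in the binary closure of
     that copy, which the binary part of the E-base forces into [M]. *)
  move=> sAM; have [B genB sB] := ext_E_generator y.
  apply: (model_E_generator modM genB).
  apply: subset_trans (sub_bin_closure cl_ext B) _.
  apply: subset_trans sB _; apply: (model_bin_closure modM).
  apply/subsetP=> _ /imsetP[u /(subsetP sAM)/imsetP[t tM ->] ->].
  exact: inlM.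
have clM : phi (base_point @: M) \subset base_point @: M.
  apply/subsetP=> u uM; apply/imsetP; exists (inl u) => //.
  have [/bigcupP[_ /imsetP[t tM ->] ut]|uNM] :=
    boolP (u \in bin_closure phi (base_point @: M)).
    apply: (subsetP binM); apply/bigcupP; exists t => //.
    by rewrite ext_closure1 !inE ut orbT.
  (* Taking all of [base_point @: M] as premise gives a new point with conclusion [u]; [inrM] puts
     it in [M], and [inlM] then puts [u] there. *)
  have nb : nonbinary_pair (base_point @: M, u) by rewrite /nonbinary_pair uM.
  have /inlM // : inr (Sub _ nb : {p | nonbinary_pair p}) \in M.
  by apply: inrM; rewrite SubK.
apply/(sub_closedP cl_ext); rewrite subUset subxx /=.
apply/subsetP=> [[u|y]]; rewrite inE.
  by move=> /(subsetP clM)/imsetP[t /inlM + ->].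
by move=> /subset_trans/(_ clM); apply: inrM.
Qed.

(** * The lift as a lattice embedding *)

Lemma ext_lift_mono : {mono ext_lift : C D / C \subset D}.
Proof.
move=> C D; apply/idP/idP; last exact: ext_liftS.
move=> /subsetP sCD; apply/subsetP=> u uC.
by have := sCD (inl u); rewrite !inE; apply.
Qed.

Lemma ext_liftI C D : ext_lift (C :&: D) = ext_lift C :&: ext_lift D.
Proof. by apply/setP=> [[u|y]]; rewrite !inE ?subsetI. Qed.

(** Lifts of closed sets have no further base points, so the union has base points [C :|: D], and
    both lifts already lie in the lift of the join. *)
Lemma ext_lift_join C D : closed phi C -> closed phi D ->
  ext_closure (ext_lift C :|: ext_lift D) = ext_lift (phi (C :|: D)).
Proof.
move=> clC clD; rewrite /ext_closure imsetU !base_point_lift //.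
apply/setUidPr; rewrite subUset.
by rewrite !ext_liftS // (subset_trans _ (sub_closure cl_phi _)) ?subsetUl ?subsetUr.
Qed.

Lemma ext_lift_sublattice : sublattice ext_closure (ext_lift @: closed_sets phi).
Proof.
split.
  apply/subsetP=> _ /imsetP[C + ->]; rewrite !inE; exact: ext_lift_closed.
move=> _ _ /imsetP[C + ->] /imsetP[D + ->]; rewrite !inE => clC clD; split.
  rewrite -ext_liftI imset_f // inE; apply/(sub_closedP cl_phi).
  by rewrite subsetI !(closure_min cl_phi) ?subsetIl ?subsetIr.
by rewrite ext_lift_join // imset_f // inE closed_phi.
Qed.

End Extension.

Theorem theorem4 (U : finType) (phi : {set U} -> {set U})
    (std_phi : standard_closure_space phi) :
  exists (T : finType) (psi : {set T} -> {set T}),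
    [/\ standard_closure_space psi,
        exists2 S : {set {set T}},
          sublattice psi S & inclusion_isomorphic (closed_sets phi) S
      & E_base_valid psi].
Proof.
have [cl std] := std_phi.
exists (extension phi), (@ext_closure U phi); split.
- split; [exact: ext_closure_operator | exact: ext_standard].
- exists (@ext_lift U phi @: closed_sets phi); first exact: ext_lift_sublattice.
  by exists (@ext_lift U phi) => // C D _ _; apply: ext_lift_mono.
- exact: ext_E_base_valid.
Qed.
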